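(* Let $q$ be a prime power and let $\varphi\in\mathbb{F}_q(x)$ be a rational function of degree $3$. Then $\varphi$ is a complete permutation rational function if and only if $3\mid q$ and $\varphi$ is a complete permutation polynomial.
   Context: A rational function $\varphi\in\mathbb{F}_q(x)$ is a permutation rational function if it induces a bijection of $\mathbb{P}^1(\mathbb{F}_q)=\mathbb{F}_q\cup\{\infty\}$. It is a complete permutation rational function if both $\varphi$ and $\varphi+x$ are permutation rational functions. A complete permutation polynomial is a polynomial $f\in\mathbb{F}_q[x]$ such that both $f$ and $f+x$ are permutation polynomials of $\mathbb{F}_q$. The degree of $f/g$ with $f,g$ coprime is $\max(\deg f,\deg g)$. *)

(* Defs.v *)
From mathcomp Require Import all_boot all_order all_algebra.

Set Implicit Arguments.
Unset Strict Implicit.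
Unset Printing Implicit Defensive.

Import GRing.Theory FracField.
Local Open Scope ring_scope.
Local Open Scope quotient_scope.

Section RationalFunctions.

Variable F : fieldType.
Implicit Types (phi : {fraction {poly F}}) (f g : {poly F}).

(* [repr phi] need not be in lowest terms, hence the division by the gcd.
   The resulting pair is determined up to a common nonzero constant, on which
   none of the definitions below depends. *)
Definition ratfun_gcd phi : {poly F} := gcdp \n_(repr phi) \d_(repr phi).
Definition ratfun_num phi : {poly F} := \n_(repr phi) %/ ratfun_gcd phi.
Definition ratfun_den phi : {poly F} := \d_(repr phi) %/ ratfun_gcd phi.

Lemma ratfun_gcd_neq0 phi : ratfun_gcd phi != 0.
Proof. by rewrite gcdp_eq0 negb_and denom_ratioP orbT. Qed.

Lemma ratfun_den_neq0 phi : ratfun_den phi != 0.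
Proof.
apply: contraNneq (denom_ratioP (repr phi)) => d0.
by rewrite -(divpK (dvdp_gcdr \n_(repr phi) \d_(repr phi))) [X in X * _]d0 mul0r.
Qed.

Lemma coprimep_ratfun phi : coprimep (ratfun_num phi) (ratfun_den phi).
Proof. by apply: coprimep_div_gcd; rewrite denom_ratioP orbT. Qed.

Lemma ratfun_numden phi :
  phi = tofrac (ratfun_num phi) / tofrac (ratfun_den phi).
Proof.
have rE : phi = tofrac \n_(repr phi) / tofrac \d_(repr phi).
  rewrite -[LHS]reprK; unlock tofrac; rewrite -[X in _ * X]pi_inv -[RHS]pi_mul.
  congr (\pi _); rewrite /mulf /invf !numden_Ratio ?oner_neq0 ?denom_ratioP //.
  by rewrite mulr1 mul1r Ratio_numden.
have nE : ratfun_num phi * ratfun_gcd phi = \n_(repr phi).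
  exact: divpK (dvdp_gcdl _ _).
have dE : ratfun_den phi * ratfun_gcd phi = \d_(repr phi).
  exact: divpK (dvdp_gcdr _ _).
apply: (etrans rE); rewrite -nE -dE !tofracM -mulf_div divff ?mulr1 //.
by rewrite tofrac_eq0 ratfun_gcd_neq0.
Qed.

Definition ratfun_degree phi : nat :=
  maxn (size (ratfun_num phi)).-1 (size (ratfun_den phi)).-1.

(* The projective line over F is [option F], with [None] the point at
   infinity.  The value at infinity compares the degrees of numerator and
   denominator; when they satisfy deg num <= deg den, it is the quotient of the
   coefficients of degree deg den. *)
Definition ratfun_eval phi (P : option F) : option F :=
  let f := ratfun_num phi in
  let g := ratfun_den phi in
  match P with
  | Some a => if g.[a] == 0 then None else Some (f.[a] / g.[a])
  | None => if (size g < size f)%N then None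
            else Some (f`_(size g).-1 / lead_coef g)
  end.

Definition perm_ratfun phi : Prop := bijective (ratfun_eval phi).

Definition complete_perm_ratfun phi : Prop :=
  perm_ratfun phi /\ perm_ratfun (phi + tofrac 'X).

Definition perm_poly f : Prop := bijective (fun a : F => f.[a]).

Definition complete_perm_poly f : Prop := perm_poly f /\ perm_poly (f + 'X).

End RationalFunctions.

(* Main.v *)
(* Write phi = f / g in lowest terms.  As phi and phi + x have the same finite
   poles, and the latter has a pole at infinity when the former does not,
   infinity is the only rational pole of both, so g is constant or an
   irreducible quadratic.

   If g is constant and 3 != 0, injectivity of a cubic
   a x^3 + b x^2 + c x + d forces b^2 = 3 a c, which cannot hold for both c and
   c + 1.

   If g = x^2 + u x + v, write phi = a x + b + (c x + d) / g.  Injectivity says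
   that, for every z, the quadratic (phi(X) - phi(z)) / (X - z), up to
   denominators, has no root X != z.  Multiplying its quadratic extension with
   that of g gives a quadratic in w that splits for every z: this is the
   equation of a curve of bidegree (2, 2) in (w, z) with two points over each z,
   hence 2q points.  One value of w makes the equation of degree at most 1 in z,
   so there are at most 2q - 1 points, unless the equation vanishes identically
   for this w.  The vanishing determines a in terms of u, v, c and d, and so
   excludes having it for both a and a + 1. *)
Require Import Defs.
From mathcomp Require Import all_boot all_order all_algebra all_field.
From mathcomp Require Import ring.

Set Implicit Arguments.
Unset Strict Implicit.
Unset Printing Implicit Defensive.

Import GRing.Theory FracField.
Local Open Scope ring_scope.

(** * Point counts on curves of bidegree (2, 2) *)

Lemma card_set_root (F : finFieldType) (p : {poly F}) :
  p != 0 -> (#|[set z | root p z]| < size p)%N.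
Proof.
move=> p_neq0; rewrite cardE; apply: max_poly_roots => //; last exact: enum_uniq.
by apply/allP => z; rewrite mem_enum inE.
Qed.

Lemma card_roots_deg2 (F : finFieldType) (p0 p1 p2 : F) :
    ~ [/\ p2 = 0, p1 = 0 & p0 = 0] ->
  (#|[set z | (p2 * z ^+ 2 + p1 * z + p0 == 0)%R]| <= (p2 != 0%R).+1)%N.
Proof.
move=> nz.
pose p := Poly (if p2 == 0 then [:: p0; p1] else [:: p0; p1; p2]).
have pE z : p.[z] = p2 * z ^+ 2 + p1 * z + p0.
  by rewrite /p; case: eqP => [->|_]; rewrite horner_Poly /=; ring.
have p_neq0 : p != 0.
  apply/eqP => p_eq0; apply: nz.
  have coef i : p`_i = 0 by rewrite p_eq0 coef0.
  move: (coef 0%N) (coef 1%N) (coef 2%N); rewrite /p !coef_Poly.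
  by case: eqP => [->|_] /= -> -> // ->.
have -> : [set z | p2 * z ^+ 2 + p1 * z + p0 == 0] = [set z | root p z].
  by apply/setP => z; rewrite !inE /root pE.
rewrite -ltnS; apply: leq_trans (card_set_root p_neq0) _.
by rewrite /p; case: eqP => _; apply: leq_trans (size_Poly _) _.
Qed.

(* On [s] the point [(w1 z, z)] is singular, so it counts twice both in its row
   and in its column. *)
Lemma biquadratic_degenerate_row (F : finFieldType) (P2 P1 P0 : F -> F)
    (P := fun w z => P2 w * z ^+ 2 + P1 w * z + P0 w)
    (w0 : F) (s : pred F) (w1 : F -> F) :
    P2 w0 = 0 ->
    (forall z, ~~ s z -> exists w w', [/\ w != w', P w z = 0 & P w' z = 0]) ->
    (forall z, s z ->
       P (w1 z) z = 0 /\ P2 (w1 z) * z *+ 2 + P1 (w1 z) = 0) ->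
  exists w, [/\ P2 w = 0, P1 w = 0 & P0 w = 0].
Proof.
move=> P2w0 simple double.
case: (pickP (fun w => [&& P2 w == 0, P1 w == 0 & P0 w == 0])) => [w|nz].
  by case/and3P=> /eqP ? /eqP ? /eqP ?; exists w.
have {}nz w : ~ [/\ P2 w = 0, P1 w = 0 & P0 w = 0].
  by case=> h2 h1 h0; move: (nz w); rewrite h2 h1 h0 eqxx.
pose m w z : nat := if s z then (w == w1 z).*2 else P w z == 0.
have le_col z : (2 <= \sum_w m w z)%N.
  rewrite /m; case: (boolP (s z)) => [sz|/simple[w [w' [neq Pw Pw']]]].
    by rewrite (bigD1 (w1 z)) //= eqxx.
  by rewrite (bigD1 w) //= Pw (bigD1 w') 1?eq_sym //= Pw' eqxx.
have ge_row w : (\sum_z m w z <= (P2 w != 0%R).+1)%N.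
  case: (pickP (fun z => s z && (w == w1 z))) => [z0 /andP[sz0 /eqP wE]|none].
    have [Pw dPw] := double _ sz0; rewrite -wE in Pw dPw.
    (* Taylor expansion at [z0]: it is a double root of the row, which therefore contains no other
       point. *)
    have PE z : P w z = P2 w * (z - z0) ^+ 2.
      transitivity (P2 w * (z - z0) ^+ 2
        + (z - z0) * (P2 w * z0 *+ 2 + P1 w) + P w z0); first by rewrite /P; ring.
      by rewrite Pw dPw; ring.
    have P2w : P2 w != 0.
      apply/eqP => P2w; case: (nz w).
      move: dPw Pw; rewrite /P P2w mul0r mul0rn add0r => P1w.
      by rewrite P1w !mul0r !add0r.
    rewrite P2w (bigD1 z0) //= big1 ?addn0.
      by rewrite /m sz0; case: (_ == _).
    move=> z neq.
    have Pz : P w z != 0 by rewrite PE mulf_neq0 // expf_neq0 // subr_eq0.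
    rewrite /m; case: ifP => [sz|_]; last by rewrite (negPf Pz).
    case: eqP => // wE'; case/eqP: Pz.
    by rewrite [in LHS]wE'; case: (double _ sz).
  apply: leq_trans (card_roots_deg2 (nz w)); rewrite -sum1dep_card [leqRHS]big_mkcond /=.
  apply: leq_sum => z _; rewrite /m; case: ifP => [sz|_]; last by case: (_ == _).
  by move: (none z); rewrite sz /= => ->.
(* With q = [#|F|], the columns give a total of at least 2q and the rows at most 1 + 2 (q - 1),
   since row [w0] has degree at most 1 in z. *)
have : (\sum_(z : F) 2 <= \sum_z \sum_w m w z)%N by apply: leq_sum.
rewrite exchange_big sum_nat_const /= (bigD1 w0) //= leqNgt; case/negP.
have := ge_row w0; rewrite P2w0 eqxx /= => le1.
apply: (@leq_ltn_trans (1 + \sum_(w | w != w0) 2)%N).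
  apply: leq_add le1 _; apply: leq_sum => w _.
  by apply: leq_trans (ge_row w) _; case: (_ == _).
rewrite !sum_nat_const (eq_card (B := predC1 w0)) // cardC1.
have : (0 < #|F|)%N by apply/card_gt0P; exists w0.
by case: #|F| => // n _; rewrite /= mulSn.
Qed.

(** * Square classes and irreducible quadratics over finite fields *)

Lemma card_le_double_imset (T T' : finType) (D : {set T}) (f : T -> T')
    (t : T -> T) :
    {in D &, forall x y, f x = f y -> y = x \/ y = t x} ->
  (#|D| <= #|f @: D|.*2)%N.
Proof.
move=> fib; rewrite -sum1_card (partition_big_imset f) /= -muln2 -sum_nat_const.
apply: leq_sum => _ /imsetP[x xD ->]; rewrite sum1dep_card.
apply: leq_trans (_ : #|[set x; t x]| <= 2)%N; last by rewrite cards2; case: (_ != _).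
apply: subset_leq_card; apply/subsetP => y; rewrite !inE => /andP[yD /eqP fy].
by case: (fib x y) => // ->; rewrite eqxx ?orbT.
Qed.

(** [H] stands for a subgroup of index at most 2 and [t] for translation by an element outside it.
    Working with bare sets covers both the nonzero squares and the values of x^2 + x. *)
Lemma half_set_cosets (T : finType) (D H : {set T}) (t : T -> T) (b : T) :
    injective t -> H \subset D -> t @: H \subset D -> [disjoint H & t @: H] ->
    (#|D| <= #|H|.*2)%N ->
  b \in D -> b \notin H -> b \in t @: H.
Proof.
move=> tinj HD tHD dis le bD bH.
have /eqP cU : #|H :|: t @: H| == (#|H| + #|t @: H|)%N by rewrite leq_card_setU.
have : H :|: t @: H == D.
  by rewrite eqEcard subUset HD tHD cU card_imset // addnn.
by move/eqP/setP/(_ b); rewrite inE (negPf bH) bD.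
Qed.

(** Squaring is at most two-to-one, so the squares fill at least half of the nonzero elements and
    [b] lies in the coset of [a]. *)
Lemma nonsquare_product (F : finFieldType) (a b : F) :
    (forall t, t ^+ 2 != a) -> (forall t, t ^+ 2 != b) ->
  exists2 t, t != 0 & a * b = t ^+ 2.
Proof.
move=> na nb.
have a0 : a != 0 by have := na 0; rewrite expr0n eq_sym.
have b0 : b != 0 by have := nb 0; rewrite expr0n eq_sym.
pose D : {set F} := [set~ 0]; pose H := (fun x : F => x ^+ 2) @: D.
have : b \in (fun x => a * x) @: H.
  apply: (@half_set_cosets _ D); last 2 first.
  - by rewrite !inE.
  - by apply/imsetP => -[t _ bE]; case/negP: (nb t); rewrite bE.
  - exact: mulfI.
  - by apply/subsetP => _ /imsetP[t + ->]; rewrite !inE => t0; rewrite expf_neq0.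
  - apply/subsetP => _ /imsetP[_ /imsetP[t + ->] ->]; rewrite !inE => t0.
    by rewrite mulf_neq0 ?expf_neq0.
  - rewrite disjoint_subset; apply/subsetP => _ /imsetP[x xD ->].
    rewrite inE; apply/imsetP => -[_ /imsetP[y + ->] xE]; rewrite !inE => y0.
    by case/eqP: (na (x / y)); rewrite expr_div_n xE mulfK // expf_neq0.
  apply: (@card_le_double_imset _ _ _ _ -%R) => x y _ _ /eqP.
  by rewrite eq_sym eqf_sqr => /orP[] /eqP; [left|right].
case/imsetP=> _ /imsetP[t + ->] ->; rewrite !inE => t0.
by exists (a * t); [rewrite mulf_neq0 | ring].
Qed.

(** Additive analogue of [nonsquare_product]: x^2 + x is additive here and at most two-to-one, so
    its values fill at least half of the field. *)
Lemma artin_schreier_sum (F : finFieldType) (a b : F) : 2 = 0 :> F ->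
    (forall t, t ^+ 2 + t != a) -> (forall t, t ^+ 2 + t != b) ->
  exists t, a + b = t ^+ 2 + t.
Proof.
move=> F2 na nb; pose H := (fun x : F => x ^+ 2 + x) @: setT.
have twice (x : F) : x + x = 0 by rewrite -mulr2n -mulr_natl F2 mul0r.
have : b \in (fun x => a + x) @: H.
  apply: (@half_set_cosets _ setT); rewrite ?subsetT ?in_setT //.
  - exact: addrI.
  - rewrite disjoint_subset; apply/subsetP => _ /imsetP[x _ ->].
    rewrite inE; apply/imsetP => -[_ /imsetP[y _ ->] xE].
    case/eqP: (na (x - y)).
    transitivity (x ^+ 2 + x - (y ^+ 2 + y) + 2 * (y ^+ 2 - x * y)); first by ring.
    by rewrite F2 xE; ring.
  - apply: (@card_le_double_imset _ _ _ _ (fun x => - (x + 1))) => x y _ _ xy.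
    have : (y - x) * (y + x + 1) = 0.
      by transitivity (y ^+ 2 + y - (x ^+ 2 + x)); [ring | rewrite xy subrr].
    move/eqP; rewrite mulf_eq0 subr_eq0 => /orP[/eqP ->|]; first by left.
    by rewrite -addrA addr_eq0 => /eqP ->; right.
  by apply/imsetP => -[t _ bE]; case/negP: (nb t); rewrite bE.
by case/imsetP=> _ /imsetP[t _ ->] ->; exists t; rewrite addrA twice add0r.
Qed.

(** Squaring is the Frobenius map, injective and hence onto by finiteness. *)
Lemma sqr_surj_char2 (F : finFieldType) (a : F) : 2 = 0 :> F ->
  exists t, a = t ^+ 2.
Proof.
move=> F2.
have sqinj : injective (fun x : F => x ^+ 2).
  move=> x y /= xy; apply/eqP; rewrite -subr_eq0 -sqrf_eq0; apply/eqP.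
  transitivity (x ^+ 2 - y ^+ 2 + 2 * (y ^+ 2 - x * y)); first by ring.
  by rewrite F2 xy; ring.
by have [g _ gK] := injF_bij sqinj; exists (g a); rewrite gK.
Qed.

(* If [x, x'] and [y, y'] are the roots, these are [x y + x' y'] and
   [x y' + x' y], both fixed by the Frobenius. *)
Lemma irreducible_quadratics_product (F : finFieldType) (u v B C : F) :
    (forall x, x ^+ 2 + u * x + v != 0) ->
    (forall y, y ^+ 2 + B * y + C != 0) ->
  exists Y1 Y2, [/\ Y1 != Y2,
    Y1 ^+ 2 - u * B * Y1 + (u ^+ 2 * C + v * B ^+ 2 - 4 * v * C) = 0 &
    Y2 ^+ 2 - u * B * Y2 + (u ^+ 2 * C + v * B ^+ 2 - 4 * v * C) = 0].
Proof.
move=> irr1 irr2; have [F2|F2] := eqVneq (2 : F) 0.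
  have neq0 (b c : F) : (forall x, x ^+ 2 + b * x + c != 0) -> b != 0.
    move=> irr; apply/eqP => b0; have [t ct] := sqr_surj_char2 (- c) F2.
    by case/eqP: (irr t); rewrite -ct b0; ring.
  (* The substitution x = b t turns the quadratic into an Artin-Schreier equation. *)
  have nonAS (b c : F) : (forall x, x ^+ 2 + b * x + c != 0) ->
      forall t, t ^+ 2 + t != c / b ^+ 2.
    move=> irr t; have b0 := neq0 _ _ irr.
    apply/eqP => tE; case/eqP: (irr (t * b)).
    transitivity (b ^+ 2 * (t ^+ 2 + t) + c); first by ring.
    rewrite tE mulrC divfK ?expf_neq0 //.
    by transitivity (2 * c); [ring | rewrite F2 mul0r].
  have [t tE] := artin_schreier_sum F2 (nonAS _ _ irr1) (nonAS _ _ irr2).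
  have u0 := neq0 _ _ irr1; have B0 := neq0 _ _ irr2.
  have key : (u * B) ^+ 2 * (t ^+ 2 + t) = v * B ^+ 2 + u ^+ 2 * C.
    by rewrite -tE; field; rewrite ?u0 ?B0.
  (* Modulo 2, putting Y = u B T turns the equation for Y into T^2 + T = v / u^2 + C / B^2, solved
     by [t] and [t + 1]. *)
  exists (u * B * t), (u * B * (t + 1)); split.
  - rewrite -subr_eq0 (_ : _ - _ = - (u * B)) ?oppr_eq0; last by ring.
    by rewrite mulf_neq0.
  - transitivity ((u * B) ^+ 2 * (t ^+ 2 + t) - (v * B ^+ 2 + u ^+ 2 * C)
      + 2 * (v * B ^+ 2 + u ^+ 2 * C - (u * B) ^+ 2 * t - 2 * v * C)); first by ring.
    by rewrite key subrr F2 mul0r addr0.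
  - transitivity ((u * B) ^+ 2 * (t ^+ 2 + t) - (v * B ^+ 2 + u ^+ 2 * C)
      + 2 * (v * B ^+ 2 + u ^+ 2 * C - 2 * v * C)); first by ring.
    by rewrite key subrr F2 mul0r addr0.
have F4 : (4 : F) != 0 by rewrite (_ : 4 = 2 * 2) ?mulf_neq0 //; ring.
have nonsq (b c : F) : (forall x, x ^+ 2 + b * x + c != 0) ->
    forall t, t ^+ 2 != b ^+ 2 - 4 * c.
  move=> irr t; apply/eqP => tE; case/eqP: (irr ((t - b) / 2)).
  transitivity ((t ^+ 2 - (b ^+ 2 - 4 * c)) / 4); first by field; rewrite ?F4 ?F2.
  by rewrite tE subrr mul0r.
have [t t0 tE] := nonsquare_product (nonsq _ _ irr1) (nonsq _ _ irr2).
(* The quadratic in Y has discriminant (u^2 - 4 v) (B^2 - 4 C) = t^2. *)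
exists ((u * B + t) / 2), ((u * B - t) / 2); split.
- rewrite -subr_eq0 (_ : _ - _ = t) //; by field; rewrite ?F4 ?F2.
- transitivity ((t ^+ 2 - (u ^+ 2 - 4 * v) * (B ^+ 2 - 4 * C)) / 4); first by field; rewrite ?F4 ?F2.
  by rewrite tE subrr mul0r.
- transitivity ((t ^+ 2 - (u ^+ 2 - 4 * v) * (B ^+ 2 - 4 * C)) / 4); first by field; rewrite ?F4 ?F2.
  by rewrite tE subrr mul0r.
Qed.

(** A zero discriminant yields a double root in [F]: - u / 2, or in characteristic 2, where it
    forces u = 0, a square root of - v. *)
Lemma irreducible_disc_neq0 (F : finFieldType) (u v : F) :
  (forall x, x ^+ 2 + u * x + v != 0) -> u ^+ 2 - 4 * v != 0.
Proof.
move=> irr; apply/eqP => disc0; have [F2|F2] := eqVneq (2 : F) 0.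
  have [t vt] := sqr_surj_char2 (- v) F2.
  have u0 : u = 0.
    apply/eqP; rewrite -sqrf_eq0; apply/eqP.
    transitivity (u ^+ 2 - 4 * v + 2 * (2 * v)); first by ring.
    by rewrite disc0 F2 mul0r addr0.
  by case/eqP: (irr t); rewrite -vt u0; ring.
have F4 : (4 : F) != 0 by rewrite (_ : 4 = 2 * 2) ?mulf_neq0 //; ring.
case/eqP: (irr (- u / 2)); transitivity (- (u ^+ 2 - 4 * v) / 4).
  by field; rewrite ?F4 ?F2.
by rewrite disc0 oppr0 mul0r.
Qed.

(** The form is the resultant of x^2 + u x + v and c x + d: c^2 times the value of the quadratic at
    - d / c, or d^2 when c = 0. *)
Lemma quadratic_form_neq0 (F : finFieldType) (u v c d : F) :
    (forall x, x ^+ 2 + u * x + v != 0) -> (c != 0) || (d != 0) ->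
  d ^+ 2 - u * c * d + v * c ^+ 2 != 0.
Proof.
move=> irr; have [->|c0 _] := eqVneq c 0.
  by move=> d0; rewrite mulr0 mul0r expr0n mulr0 subr0 addr0 expf_neq0.
have := irr (- d / c); apply: contra_neq => N0.
transitivity ((d ^+ 2 - u * c * d + v * c ^+ 2) / c ^+ 2); first by field.
by rewrite N0 mul0r.
Qed.

(** * Rational functions with an irreducible quadratic denominator *)

(** The last hypothesis concerns the numerator of the difference quotient of a x + (c x + d) / g.
    The two equations are read off the coefficients of a degenerate row. *)
Lemma difference_quotient_rigidity (F : finFieldType) (u v a c d : F)
    (g := fun x => x ^+ 2 + u * x + v) :
    (forall x, g x != 0) -> a != 0 -> (c != 0) || (d != 0) ->
    (forall x z, x != z ->
       a * g x * g z - c * x * z - d * (x + z) - d * u + c * v != 0) ->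
  u * c = 2 * d /\
  d ^+ 2 - u * c * d + v * c ^+ 2 = (u ^+ 2 - 4 * v) * a * (d * u - 2 * v * c).
Proof.
move=> irr a0 cd0 inj.
have disc0 := irreducible_disc_neq0 irr.
have N0 := quadratic_form_neq0 irr cd0.
set disc := u ^+ 2 - 4 * v in disc0 *.
set N := d ^+ 2 - _ + _ in N0 *.
pose G x z := a * g x * g z - c * x * z - d * (x + z) - d * u + c * v.
(* [P2 w * z ^+ 2 + P1 w * z + P0 w] is the quadratic of
   [irreducible_quadratics_product] for [g] and the monic form of [G _ z], at
   [Y = w + 2 v A z - k z]; this shift cancels the terms of degree 3 and 4 in
   [z]. *)
pose h w := w - (d * u - c * v).
pose P2 w := N - disc * a * w.
pose P1 w := - (2 * d * h w) + u * (c * h w - d ^+ 2) + 2 * v * c * d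
             - disc * a * w * u.
pose P0 w := h w ^+ 2 + u * d * h w + v * d ^+ 2 - disc * a * w * v.
pose A z := a * g z; pose l z := c * z + d; pose k z := d * z + d * u - c * v.
have PE w z : P2 w * z ^+ 2 + P1 w * z + P0 w
    = (w - k z) ^+ 2 + u * l z * (w - k z) + v * l z ^+ 2 - disc * A z * w.
  by rewrite /P2 /P1 /P0 /A /l /k /g /h /N; ring.
have GE x z : G x z = A z * x ^+ 2 + (u * A z - l z) * x + (v * A z - k z).
  by rewrite /G /A /l /k /g; ring.
have A0 z : A z != 0 by rewrite mulf_neq0 // irr.
(* The chosen row is the one where [P2] vanishes. If [G z z = 0], then [G _ z] turns out to be A z
   (x - z)^2, so both values of Y equal - u z A z, which corresponds to w = - a g(z)^2. *)
have [||| w [w2 w1 w0]] := @biquadratic_degenerate_row F P2 P1 P0 (N / (disc * a))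
  (fun z => G z z == 0) (fun z => - a * g z ^+ 2).
- by rewrite /P2 mulrC divfK ?subrr // mulf_neq0.
- move=> z Gz.
  have irrG y : y ^+ 2 + (u * A z - l z) * y + A z * (v * A z - k z) != 0.
    have : G (y / A z) z != 0.
      by have [->|/inj] := eqVneq (y / A z) z.
    apply: contra_neq => yroot; rewrite GE.
    transitivity ((y ^+ 2 + (u * A z - l z) * y + A z * (v * A z - k z)) / A z).
      by field.
    by rewrite yroot mul0r.
  have [Y1 [Y2 [neq Y1E Y2E]]] := irreducible_quadratics_product irr irrG.
  exists (Y1 - 2 * v * A z + k z), (Y2 - 2 * v * A z + k z); split.
  + by rewrite (inj_eq (addIr _)) (inj_eq (addIr _)).
  + by rewrite PE -[RHS]Y1E /disc; ring.
  + by rewrite PE -[RHS]Y2E /disc; ring.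
- move=> z /eqP Gz.
  (* By Vieta, [z'] is the other root of [G _ z]; roots off the diagonal being excluded, [z] is a
     double root. *)
  pose z' := - (u * A z - l z) / A z - z.
  have z'E : z' = z.
    apply/eqP/contraT => /inj/eqP[]; rewrite -[LHS]/(G z' z) GE -[RHS]Gz GE /z'.
    by field.
  have lE : l z = (u + 2 * z) * A z.
    apply/eqP; rewrite -subr_eq0; apply/eqP.
    transitivity (A z * (z' - z)); first by rewrite /z'; field.
    by rewrite z'E subrr mulr0.
  have kE : k z = (v - z ^+ 2) * A z.
    move: Gz; rewrite GE lE => Gz; apply/eqP; rewrite -subr_eq0; apply/eqP.
    by rewrite -[RHS]oppr0 -Gz; ring.
  have w1E : - a * g z ^+ 2 = - A z * g z by rewrite /A; ring.
  split; first by rewrite PE w1E lE kE /g /disc; ring.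
  set w1 := - a * g z ^+ 2.
  transitivity ((u * c - 2 * d) * (w1 - k z) + (2 * v * c - u * d) * l z
                - disc * a * w1 * (u + 2 * z)).
    by rewrite /P2 /P1 /h /k /l /N; ring.
  rewrite /w1 {1}w1E {1}kE {1}lE.
  transitivity (disc * A z * ((u + 2 * z) * A z - l z)).
    by rewrite /A /l /g /disc; ring.
  by rewrite lE subrr mulr0.
(* Given [wE], the coefficients factor as P1 = w (u c - 2 d) and P0 = w (h w + v c), where w is
   nonzero because [N] is; [neq] states this with w expanded. *)
- have wE : disc * a * w = N by apply/esym/eqP; rewrite -subr_eq0; apply/eqP.
  have neq : h w + u * d - v * c != 0.
    rewrite (_ : _ - _ = w); last by rewrite /h; ring.
    by apply: contraNneq N0 => w_eq0; rewrite -wE w_eq0 mulr0.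
  have e1 : u * c = 2 * d.
    apply/eqP; rewrite -subr_eq0 -(mulrI_eq0 _ (mulfI neq)); apply/eqP.
    by rewrite -[RHS]w1 /P1 wE /N; ring.
  have e2 : h w + v * c = 0.
    apply/eqP; rewrite -(mulrI_eq0 _ (mulfI neq)); apply/eqP.
    by rewrite -[RHS]w0 /P0 wE /N; ring.
  split=> //; rewrite -wE (_ : w = h w + v * c + (d * u - 2 * v * c)).
    by rewrite e2 add0r.
  by rewrite /h; ring.
Qed.

(** * Injective cubic polynomials *)

(** The difference quotient is x^2 + x z + z^2 + k; the argument depends on whether its quadratic
    part splits, that is, on whether [F] contains a primitive cube root of unity. *)
Lemma depressed_cubic_injective (F : finFieldType) (k : F) :
  3 != 0 :> F -> injective (fun x : F => x ^+ 3 + k * x) -> k = 0.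
Proof.
move=> F3 inj; apply/eqP; apply: contraT => k0.
have diff x z : x != z -> x ^+ 2 + x * z + z ^+ 2 + k != 0.
  apply: contra_neq => e; apply: inj; apply/eqP; rewrite -subr_eq0; apply/eqP.
  transitivity ((x - z) * (x ^+ 2 + x * z + z ^+ 2 + k)); first by ring.
  by rewrite e mulr0.
case: (pickP (fun o : F => o ^+ 2 + 1 * o + 1 == 0)) => [o /eqP oE|irr].
  have o2 : o ^+ 2 = - o - 1.
    by apply/eqP; rewrite -subr_eq0 -oE; apply/eqP; ring.
  have s0 : 1 + 2 * o != 0.
    apply: contra_neq F3 => s0.
    transitivity (4 * (o ^+ 2 + 1 * o + 1) - (1 + 2 * o) ^+ 2); first by ring.
    by rewrite oE s0; ring.
  have o0 : o != 0.
    by apply/eqP => o0; move/eqP: oE; rewrite o0 expr0n mulr0 !add0r oner_eq0.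
  have o1 : 1 - o != 0.
    rewrite -sqrf_eq0 (_ : _ ^+ 2 = - 3 * o + (o ^+ 2 + 1 * o + 1)); last by ring.
    by rewrite oE addr0 mulf_neq0 // oppr_eq0.
  (* [x ^+ 2 + x * z + z ^+ 2 = (x - o z) (x - o^2 z)]; prescribe the factors
     [p] and [- k / p]. *)
  have key p : p != 0 -> (1 + o) * p ^+ 2 + k = 0.
    move=> p0; pose z := - (k / p + p) / (1 + 2 * o).
    pose x := p + o * z.
    have zE : z * (1 + 2 * o) = - (k / p + p) by rewrite /z divfK.
    have e : x ^+ 2 + x * z + z ^+ 2 + k = 0.
      transitivity (z ^+ 2 * (o ^+ 2 + 1 * o + 1) + p * (z * (1 + 2 * o)) + p ^+ 2 + k).
        by rewrite /x; ring.
      by rewrite oE zE; field.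
    have xz : x = z by apply/eqP; apply: contraT => /diff; rewrite e eqxx.
    have pz : p = (1 - o) * z.
      by transitivity (x - o * z); [rewrite /x | rewrite xz]; ring.
    have : (1 - o) * ((1 + o) * p ^+ 2 + k) = 0.
      transitivity (p * (p * (1 + 2 * o) - (1 - o) * (z * (1 + 2 * o)))
                    - (o ^+ 2 + 1 * o + 1) * p ^+ 2).
        by rewrite zE; field.
      by rewrite {2}pz oE; ring.
    by move/eqP; rewrite mulf_eq0 (negPf o1) => /eqP.
  (* The instances p = 1 and p = o differ by (1 + o)^2 (1 - o), so 1 + o = 0 and then o^2 = - o - 1
     = 0. *)
  have := key 1 (oner_neq0 _); have := key o o0 => ko k1.
  have : (1 + o) ^+ 2 * (1 - o) = 0.
    transitivity ((1 + o) * 1 ^+ 2 + k - ((1 + o) * o ^+ 2 + k)); first by ring.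
    by rewrite ko k1 subrr.
  move/eqP; rewrite mulf_eq0 (negPf o1) orbF sqrf_eq0 => /eqP o1E.
  case/eqP: o0; apply/eqP; rewrite -sqrf_eq0; apply/eqP.
  by rewrite o2 -opprD addrC o1E oppr0.
have {}irr (o : F) : o ^+ 2 + 1 * o + 1 != 0 by rewrite irr.
(* For every z, a root Y of the product quadratic gives p = Y - 2 z with p (p + 3 z) = 3 k, so p is
   nonzero and z = f p. Thus [f] would map the nonzero elements onto all of [F]. *)
pose f p := (3 * k / p - p) / 3.
have f_onto : setT \subset f @: [set~ 0].
  apply/subsetP => z _.
  have irrz y : y ^+ 2 + z * y + (z ^+ 2 + k) != 0.
    rewrite (_ : _ + _ = y ^+ 2 + y * z + z ^+ 2 + k); last by ring.
    have [->|/diff //] := eqVneq y z.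
    have [z0|z0] := eqVneq z 0; first by rewrite z0 expr0n mulr0 !add0r.
    rewrite (_ : _ + k = (- 2 * z) ^+ 2 + - 2 * z * z + z ^+ 2 + k); last by ring.
    apply: diff; rewrite -subr_eq0 (_ : _ - z = - (3 * z)); last by ring.
    by rewrite oppr_eq0 mulf_neq0.
  have [Y [_ [_ + _]]] := irreducible_quadratics_product irr irrz.
  move=> YE; have pE : (Y - 2 * z) * (Y - 2 * z + 3 * z) = 3 * k.
    by apply/eqP; rewrite -subr_eq0 -YE; apply/eqP; ring.
  have p0 : Y - 2 * z != 0.
    by apply: contraTneq (mulf_neq0 F3 k0) => p0; rewrite -pE p0 mul0r eqxx.
  apply/imsetP; exists (Y - 2 * z); first by rewrite !inE.
  by rewrite /f -pE; field; rewrite F3.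
have := leq_trans (subset_leq_card f_onto) (leq_imset_card _ _).
rewrite cardsT cardsC1 leqNgt prednK ?leqnn //.
by apply/card_gt0P; exists 0.
Qed.

(** Replacing x by x - s removes the quadratic term and leaves k = (3 a c - b^2) / (3 a^2). *)
Lemma cubic_injective (F : finFieldType) (a b c d : F) :
    3 != 0 :> F -> a != 0 ->
    injective (fun x => a * x ^+ 3 + b * x ^+ 2 + c * x + d) ->
  b ^+ 2 = 3 * a * c.
Proof.
move=> F3 a0 inj; pose s := b / (3 * a); pose k := c / a - 3 * s ^+ 2.
have k0 : k = 0.
  apply: (depressed_cubic_injective F3) => x y xy.
  have shift z : a * (z - s) ^+ 3 + b * (z - s) ^+ 2 + c * (z - s) + d
      = a * (z ^+ 3 + k * z) + (d - c * s + b * s ^+ 2 - a * s ^+ 3).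
    by rewrite /k /s; field; rewrite ?F3 ?a0.
  by apply: (addIr (- s)); apply: inj; rewrite /= !shift xy.
apply/eqP; rewrite -subr_eq0; apply/eqP.
transitivity (- 3 * a ^+ 2 * k); last by rewrite k0 mulr0.
by rewrite /k /s; field; rewrite ?F3 ?a0.
Qed.

Lemma injective_cubic_ratfun (F : finFieldType) (u v a b c d : F)
    (g := fun x => x ^+ 2 + u * x + v) :
    (forall x, g x != 0) -> a != 0 -> (c != 0) || (d != 0) ->
    injective (fun x => a * x + b + (c * x + d) / g x) ->
  u * c = 2 * d /\
  d ^+ 2 - u * c * d + v * c ^+ 2 = (u ^+ 2 - 4 * v) * a * (d * u - 2 * v * c).
Proof.
move=> irr a0 cd0 inj; apply: difference_quotient_rigidity => // x z.
apply: contra_neq => E; apply: inj; apply/eqP; rewrite -subr_eq0; apply/eqP.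
transitivity ((x - z) * (a * g x * g z - c * x * z - d * (x + z) - d * u + c * v)
   / (g x * g z)); last by rewrite E mulr0 mul0r.
by move: (irr x) (irr z); rewrite /g => gx gz /=; field; rewrite gx gz.
Qed.

Lemma char3_card (F : finFieldType) : 3 = 0 :> F -> (3 %| #|F|)%N.
Proof.
move=> F3; have ch3 : 3%N \in [pchar F] by rewrite inE /= F3 eqxx.
have := card_pprimeChar ch3; rewrite /pPrimeCharType /= => cardE.
have := finNzRing_gt1 F; rewrite cardE; case: (logn _ _) => // n _.
by rewrite expnS dvdn_mulr.
Qed.

(** * Evaluation through coprime fractions, and poles *)

Section Fractions.
Variables (F : fieldType) (phi : {fraction {poly F}}) (f g : {poly F}).
Hypotheses (fg_coprime : coprimep f g) (g_neq0 : g != 0).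
Hypothesis phiE : phi = tofrac f / tofrac g.

(** After cross-multiplying, coprimality makes each denominator divide the other. Evaluation can
    then use any coprime pair. *)
Lemma ratfun_numden_unique : exists2 c : F, c != 0 &
  ratfun_num phi = c *: f /\ ratfun_den phi = c *: g.
Proof.
have d0 := ratfun_den_neq0 phi.
have cross : ratfun_num phi * g = f * ratfun_den phi.
  apply/eqP; rewrite -tofrac_eq !tofracM -eqr_div ?tofrac_eq0 //.
  by rewrite -ratfun_numden phiE.
have : g %= ratfun_den phi.
  rewrite /eqp; apply/andP; split.
    rewrite -(@Gauss_dvdpr _ _ f) 1?coprimep_sym //.
    by rewrite -cross dvdp_mull.
  rewrite -(@Gauss_dvdpr _ _ (ratfun_num phi)) 1?coprimep_sym ?coprimep_ratfun //.
  by rewrite cross dvdp_mull.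
case/eqpP=> -[c1 c2] /= /andP[c1_0 c2_0] cE.
have denE : ratfun_den phi = (c1 / c2) *: g.
  by rewrite mulrC -scalerA cE scalerA mulVf // scale1r.
exists (c1 / c2); first by rewrite mulf_neq0 ?invr_eq0.
split=> //; apply: (mulIf g_neq0); rewrite cross denE.
by rewrite -scalerAr scalerAl.
Qed.

Lemma ratfun_eval_Some x :
  ratfun_eval phi (Some x) = if g.[x] == 0 then None else Some (f.[x] / g.[x]).
Proof.
have [c c0 [nE dE]] := ratfun_numden_unique.
rewrite /ratfun_eval nE dE !hornerZ mulf_eq0 (negPf c0) /=.
by case: eqP => // _; rewrite -mulf_div divff // mul1r.
Qed.

Lemma ratfun_eval_None :
  (ratfun_eval phi None == None) = (size g < size f)%N.
Proof.
have [c c0 [nE dE]] := ratfun_numden_unique.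
by rewrite /ratfun_eval nE dE !size_scale //; case: ltnP.
Qed.

Lemma ratfun_addX : phi + tofrac 'X = tofrac (f + g * 'X) / tofrac g.
Proof.
by rewrite phiE tofracD tofracM mulrDl [tofrac g * _]mulrC mulfK // tofrac_eq0.
Qed.

Lemma coprimep_addX : coprimep (f + g * 'X) g.
Proof. by rewrite coprimep_sym addrC mulrC coprimep_addl_mul coprimep_sym. Qed.

End Fractions.

Lemma complete_perm_ratfun_infty (F : fieldType) (phi : {fraction {poly F}})
    (f := ratfun_num phi) (g := ratfun_den phi) :
    complete_perm_ratfun phi ->
  [/\ (size g < size f)%N, (size g < size (f + g * 'X)%R)%N,
      forall x, g.[x] != 0,
      injective (fun x => f.[x] / g.[x]) &
      injective (fun x => f.[x] / g.[x] + x)].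
Proof.
case=> [[h hK Kh] [h' hK' Kh']].
have fg := coprimep_ratfun phi; have g0 := ratfun_den_neq0 phi.
have phiE := ratfun_numden phi.
have fg' := coprimep_addX fg; have psiE := ratfun_addX g0 phiE.
have ev := ratfun_eval_Some fg g0 phiE; have evN := ratfun_eval_None fg g0 phiE.
have ev' := ratfun_eval_Some fg' g0 psiE.
have evN' := ratfun_eval_None fg' g0 psiE.
rewrite -/f -/g in g0 ev evN ev' evN'.
have lt_gf : (size g < size f)%N.
  (* Otherwise the preimage x of infinity is a finite pole, and [phi + x] takes the value infinity
     both there and at infinity. *)
  rewrite ltnNge; apply/negP => le_fg.
  have := Kh None; case: (h None) => [x|]; last first.
    by move/eqP; rewrite evN ltnNge le_fg.
  rewrite ev; case: eqP => // gx _.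
  have : ratfun_eval (phi + tofrac 'X) None = ratfun_eval (phi + tofrac 'X) (Some x).
    apply/eqP; rewrite ev' gx eqxx evN' addrC size_polyDl size_mulX //.
  by move/(can_inj hK').
have phiN : ratfun_eval phi None = None by apply/eqP; rewrite evN.
have gx0 x : g.[x] != 0.
  apply/eqP => gx; have : ratfun_eval phi (Some x) = ratfun_eval phi None.
    by rewrite ev gx eqxx phiN.
  by move/(can_inj hK).
split=> //.
(* The sum has the same denominator, without zeros in [F], so infinity can only be attained at
   infinity. *)
- rewrite -evN'; case: (h' None) (Kh' None) => [x|-> //].
  by rewrite ev' (negPf (gx0 x)).
- move=> x y xy; have : ratfun_eval phi (Some x) = ratfun_eval phi (Some y).
    by rewrite !ev !(negPf (gx0 _)) xy.
  by move/(can_inj hK) => -[].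
- move=> x y xy; have : ratfun_eval (phi + tofrac 'X) (Some x)
      = ratfun_eval (phi + tofrac 'X) (Some y).
    rewrite !ev' !(negPf (gx0 _)) !hornerE !mulrDl.
    by rewrite ![g.[_] * _]mulrC !mulfK // xy.
  by move/(can_inj hK') => -[].
Qed.

Lemma perm_ratfun_tofrac (F : fieldType) (f : {poly F}) :
  (1 < size f)%N -> perm_poly f -> perm_ratfun (tofrac f).
Proof.
move=> size_f [h hK Kh].
have f1 : coprimep f 1 by rewrite coprimep1.
have fE : tofrac f = tofrac f / tofrac 1 by rewrite tofrac1 divr1.
have ev x : ratfun_eval (tofrac f) (Some x) = Some f.[x].
  by rewrite (ratfun_eval_Some f1 _ fE) ?oner_neq0 // hornerC oner_eq0 divr1.
have evN : ratfun_eval (tofrac f) None = None.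
  by apply/eqP; rewrite (ratfun_eval_None f1 _ fE) ?oner_neq0 // size_poly1.
exists (omap h) => -[x|].
- by rewrite ev /= hK.
- by rewrite evN.
- by rewrite [omap _ _]/= ev Kh.
- by rewrite [omap _ _]/= evN.
Qed.

(** * The classification in degree 3 *)

Theorem theorem7p1 (F : finFieldType) (phi : {fraction {poly F}})
    (hdeg : ratfun_degree phi = 3%N) :
  complete_perm_ratfun phi <->
  (3 %| #|F|)%N /\
    (exists f : {poly F}, phi = tofrac f /\ complete_perm_poly f).
Proof.
split; last first.
  case=> _ [f [phiE [fP fXP]]].
  have size_f : size f = 4%N.
    have fE : phi = tofrac f / tofrac 1 by rewrite tofrac1 divr1.
    have [|c c0 [nE dE]] := ratfun_numden_unique _ (oner_neq0 _) fE.
      by rewrite coprimep1.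
    move: hdeg; rewrite /ratfun_degree nE dE !size_scale // size_poly1 maxn0.
    by case: (size f) => //= n ->.
  split; rewrite phiE; first by apply: perm_ratfun_tofrac; rewrite ?size_f.
  rewrite -tofracD; apply: perm_ratfun_tofrac => //.
  by rewrite size_polyDl size_f ?size_polyX.
move=> cp; have [lt_gf lt_gfX gx0 inj injX] := complete_perm_ratfun_infty cp.
have fg := coprimep_ratfun phi; have g0 := ratfun_den_neq0 phi.
have phiE := ratfun_numden phi.
move: hdeg lt_gf lt_gfX gx0 inj injX fg g0 phiE; rewrite /ratfun_degree.
set f := ratfun_num phi; set g := ratfun_den phi.
move=> deg lt_gf lt_gfX gx0 inj injX fg g0 phiE.
have size_f : size f = 4%N.
  move: deg; have /maxn_idPl -> : ((size g).-1 <= (size f).-1)%N.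
    by rewrite -!subn1 leq_sub2r // ltnW.
  by case: (size f) => //= n ->.
have : size g \in [:: 1%N; 2%N; 3%N].
  move: lt_gf; rewrite size_f; have : (0 < size g)%N by rewrite size_poly_gt0.
  by case: (size g) => [|[|[|[|]]]].
rewrite !inE => /or3P[] /eqP size_g.
- have [c c0 gE] : exists2 c, c != 0 & g = c%:P.
    by move/eqP: size_g => /size_poly1P.
  pose p := c^-1 *: f.
  have pE : phi = tofrac p.
    have cf : f = p * c%:P by rewrite mulrC mul_polyC scalerA divff ?scale1r.
    by rewrite phiE gE [in LHS]cf tofracM mulfK // tofrac_eq0 polyC_eq0.
  have px x : p.[x] = f.[x] / g.[x] by rewrite gE hornerZ hornerC mulrC.
  have pinj : injective (fun x => p.[x]) by move=> x y; rewrite /= !px; apply: inj.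
  have pXinj : injective (fun x => (p + 'X).[x]).
    by move=> x y; rewrite /= !hornerD !hornerX !px; apply: injX.
  split; last by exists p; split=> //; split; apply: injF_bij.
  have size_p : (size p <= 4)%N by rewrite size_scale ?invr_eq0 // size_f.
  have hp x : p.[x] = p`_3 * x ^+ 3 + p`_2 * x ^+ 2 + p`_1 * x + p`_0.
    by rewrite (horner_coef_wide _ size_p) !big_ord_recl big_ord0 /=; ring.
  have p3 : p`_3 != 0.
    rewrite coefZ mulf_neq0 ?invr_eq0 //.
    by rewrite -[3%N]/(4.-1)%N -size_f -lead_coefE lead_coef_eq0 -size_poly_eq0 size_f.
  apply: char3_card; apply/eqP; apply: contraT => F3.
  have e1 : p`_2 ^+ 2 = 3 * p`_3 * p`_1.
    by apply: (@cubic_injective _ _ _ _ p`_0) => // x y; rewrite -!hp; apply: pinj.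
  have hpX x : (p + 'X).[x]
      = p`_3 * x ^+ 3 + p`_2 * x ^+ 2 + (p`_1 + 1) * x + p`_0.
    by rewrite hornerD hornerX hp; ring.
  have e2 : p`_2 ^+ 2 = 3 * p`_3 * (p`_1 + 1).
    by apply: (@cubic_injective _ _ _ _ p`_0) => // x y; rewrite -!hpX; apply: pXinj.
  have : 3 * p`_3 = 0.
    transitivity (3 * p`_3 * (p`_1 + 1) - 3 * p`_3 * p`_1); first by ring.
    by rewrite -e1 -e2 subrr.
  by move/eqP; rewrite mulf_eq0 (negPf F3) (negPf p3).
(* A linear denominator would give a finite pole. *)
- have [r] := poly2_root size_g.
  by rewrite rootE (negPf (gx0 r)).
exfalso.
pose q := f %/ g; pose r := f %% g.
have fE : f = q * g + r := divp_eq f g.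
have size_q : size q = 2%N by rewrite size_divp // size_f size_g.
have size_r : (size r < 3)%N by rewrite -size_g ltn_modp.
(* The pole of the sum at infinity keeps its polynomial part of degree 1; hence [q1X], the condition
   on the leading coefficient needed for the second use of rigidity. *)
have size_qX : size (q + 'X) = 2%N.
  have -> : q + 'X = (f + g * 'X) %/ g by rewrite divpD mulKp.
  rewrite size_divp // size_g.
  suff -> : size (f + g * 'X) = 4%N by [].
  apply/eqP; rewrite eqn_leq; apply/andP; split; last by rewrite -size_g.
  by rewrite (leq_trans (size_polyD _ _)) // size_f size_mulX // size_g.
have lead2 (p : {poly F}) : size p = 2%N -> p`_1 != 0.
  by move=> size_p; rewrite -[1%N]/(2.-1)%N -size_p -lead_coefE lead_coef_eq0 -size_poly_eq0 size_p.
have q1 := lead2 _ size_q.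
have q1X : q`_1 + 1 != 0 by move: (lead2 _ size_qX); rewrite coefD coefX.
have g2 : g`_2 != 0.
  by rewrite -[2%N]/(3.-1)%N -size_g -lead_coefE lead_coef_eq0.
have hg x : g.[x] = g`_2 * (x ^+ 2 + g`_1 / g`_2 * x + g`_0 / g`_2).
  rewrite (@horner_coef_wide _ 3) ?size_g // !big_ord_recl big_ord0 /=.
  by field.
have hq x : q.[x] = q`_1 * x + q`_0.
  by rewrite (@horner_coef_wide _ 2) ?size_q // !big_ord_recl big_ord0 /=; ring.
have hr x : r.[x] = r`_1 * x + r`_0.
  by rewrite (@horner_coef_wide _ 2) // !big_ord_recl big_ord0 /=; ring.
set u := g`_1 / g`_2 in hg; set v := g`_0 / g`_2 in hg.
have irr x : x ^+ 2 + u * x + v != 0.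
  by apply: contra_neq (gx0 x) => e; rewrite hg e mulr0.
pose c := r`_1 / g`_2; pose d := r`_0 / g`_2.
(* A zero remainder would make the nonconstant g divide f, against coprimality. *)
have cd0 : (c != 0) || (d != 0).
  rewrite -negb_and; apply/negP => /andP[/eqP c0 /eqP d0].
  have r0 : r = 0.
    have z i : r`_i = 0.
      case: i => [|[|i]]; last by rewrite nth_default // (@leq_trans 2).
      - by rewrite -(divfK g2 r`_0) -/d d0 mul0r.
      - by rewrite -(divfK g2 r`_1) -/c c0 mul0r.
    by apply/polyP => i; rewrite z coef0.
  have : g %| f by rewrite /dvdp -/r r0.
  move/coprimepP: fg => /(_ g) + gf; move/(_ gf (dvdpp g)).
  by rewrite -size_poly_eq1 size_g.
have valE x : f.[x] / g.[x] = q`_1 * x + q`_0 + (c * x + d) / (x ^+ 2 + u * x + v).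
  have gx := irr x.
  rewrite fE hornerD hornerM hq hr hg /c /d.
  by move: (x ^+ 2 + u * x + v) gx => w gx; field; rewrite ?g2 ?gx.
have [e1 e2] : u * c = 2 * d /\ d ^+ 2 - u * c * d + v * c ^+ 2
    = (u ^+ 2 - 4 * v) * q`_1 * (d * u - 2 * v * c).
  apply: (@injective_cubic_ratfun _ _ _ _ q`_0) => // x y.
  by rewrite -!valE; apply: inj.
have valXE x : f.[x] / g.[x] + x
    = (q`_1 + 1) * x + q`_0 + (c * x + d) / (x ^+ 2 + u * x + v).
  by rewrite valE; ring.
have [_ e3] : u * c = 2 * d /\ d ^+ 2 - u * c * d + v * c ^+ 2
    = (u ^+ 2 - 4 * v) * (q`_1 + 1) * (d * u - 2 * v * c).
  apply: (@injective_cubic_ratfun _ _ _ _ q`_0) => // x y.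
  by rewrite -!valXE; apply: injX.
have e4 : (u ^+ 2 - 4 * v) * (d * u - 2 * v * c) = 0.
  transitivity ((u ^+ 2 - 4 * v) * (q`_1 + 1) * (d * u - 2 * v * c)
    - (u ^+ 2 - 4 * v) * q`_1 * (d * u - 2 * v * c)); first by ring.
  by rewrite -e2 -e3 subrr.
case/eqP: (quadratic_form_neq0 irr cd0); rewrite e2.
transitivity (q`_1 * ((u ^+ 2 - 4 * v) * (d * u - 2 * v * c))); first by ring.
by rewrite e4 mulr0.
Qed.
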